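(* Let $c>0$ and assume that $\Phi=(\phi_1,\dots,\phi_m)\in C$ is a positive solution of $$\phi_i(\xi)=\int_{\mathbb R}P_i\big[\phi_1(s-\tau c+c),\dots,\phi_1(s),\phi_2(s-\tau c+c),\dots,\phi_m(s)\big]\,k_i(\xi-s-c)\,ds,\qquad i\in I,\ \xi\in\mathbb R .$$ Let $[\mathbf R(s),\mathbf T(s)]$ be a contracting rectangle (defined in the context) of the difference system $$u^i_{n+1}=P_i[u^1_{n-\tau+1},\dots,u^1_n,u^2_{n-\tau+1},\dots,u^m_n],\qquad i\in I.$$ If for some $s_1\in(0,1)$ $$\mathbf R(s_1)\le\liminf_{\xi\to+\infty}\Phi(\xi)\le\limsup_{\xi\to+\infty}\Phi(\xi)\le\mathbf T(s_1)$$ (componentwise), then $\lim_{\xi\to+\infty}\Phi(\xi)=\mathbf E$.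
   Context: Let $m,\tau\in\mathbb N$, $I=\{1,\dots,m\}$, $J=\{1,\dots,\tau\}$. $C$ is the set of uniformly continuous bounded functions $\mathbb R\to\mathbb R^m$; inequalities between vectors are componentwise, and $\mathbf a\ll\mathbf b$ means strict inequality in every component. The functions $P_i:\mathbb R^{m\times\tau}\to\mathbb R$ ($i\in I$), with arguments ordered as $[h_{11},h_{12},\dots,h_{1\tau},h_{21},\dots,h_{m\tau}]$, satisfy: (P1) there is $\mathbf M=(M_1,\dots,M_m)$ such that $0\le P_i[h_{11},\dots,h_{m\tau}]\le M_i$ for all $i\in I$ whenever $0\le h_{lj}\le M_l$ for all $l\in I,j\in J$; (P2) there is $L>0$ with $|P_i[h_{11},\dots,h_{m\tau}]-P_i[f_{11},\dots,f_{m\tau}]|\le L\sum_{l\in I,j\in J}|h_{lj}-f_{lj}|$ whenever $h_{lj},f_{lj}\in[0,M_l]$; (P3) $P_i[0,\dots,0]=0$ and there is $\mathbf E=(E_1,\dots,E_m)$ with $P_i[E_1,\dots,E_1,E_2,\dots,E_2,\dots,E_m,\dots,E_m]=E_i$ (each $E_l$ repeated $\tau$ times) for all $i\in I$; (P4) $\mathbf 0\ll\mathbf E\le\mathbf M$. The kernels $k_i:\mathbb R\to[0,\infty)$ satisfy: (k1) $k_i$ is Lebesgue measurable and integrable; (k2) $k_i(x)=k_i(-x)$; (k3) $\int_{\mathbb R}k_i(y)\,dy=1$ and $\int_{\mathbb R}k_i(y)e^{\lambda y}dy<\infty$ for every $\lambda\ge0$. In the integral equation the arguments of $P_i$ are,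 in order, $\phi_l(s-(\tau-j)c)$ for $l\in I$, $j=1,\dots,\tau$. Contracting rectangle: let $\mathbf R(s)=(r_1(s),\dots,r_m(s))$, $\mathbf T(s)=(t_1(s),\dots,t_m(s))$, $s\in[0,1]$. $[\mathbf R(s),\mathbf T(s)]$ is a contracting rectangle of the difference system if (C1) $r_i,t_i$ are continuous on $[0,1]$, $i\in I$; (C2) $r_i$ is strictly increasing and $t_i$ is strictly decreasing on $[0,1]$, $i\in I$; (C3) $\mathbf 0\le\mathbf R(0)<\mathbf R(1)=\mathbf E=\mathbf T(1)<\mathbf T(0)\le\mathbf M$; (C4) for each $s\in(0,1)$ and $i\in I$, $r_i(s)<P_i[u^1_1,\dots,u^1_\tau,u^2_1,\dots,u^m_\tau]<t_i(s)$ whenever $u^j_l\in[r_j(s),t_j(s)]$ for all $j\in I$, $l\in J$.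
   Formalization: The functions s ↦ P_i[φ_1(s−τc+c),…,φ_m(s)] are assumed bounded on ℝ; this is automatic if Φ ≤ M or if the P_i are continuous, and without it the claim fails, since nothing is assumed about P_i outside [0,M]. *)

(* Defs.v *)
From mathcomp Require Import all_boot all_order all_algebra.
From mathcomp Require Import all_classical all_reals all_analysis.

Set Implicit Arguments.
Unset Strict Implicit.
Unset Printing Implicit Defensive.

Import Order.TTheory GRing.Theory Num.Theory.
Import numFieldNormedType.Exports.

Local Open Scope classical_set_scope.
Local Open Scope ring_scope.

(* An argument list [h_11, ..., h_1tau, h_21, ..., h_mtau] is the matrix of its
   entries, species l along the rows and delay j along the columns; a vector
   of R^m is a row vector. *)

Definition in_box (R : realType) (m tau : nat) (a b : 'rV[R]_m)
    (h : 'M[R]_(m, tau)) : Prop :=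
  forall (l : 'I_m) (j : 'I_tau), a 0 l <= h l j <= b 0 l.

(* The history [E_1, ..., E_1, E_2, ..., E_m, ..., E_m]. *)
Definition const_history (R : realType) (m tau : nat) (a : 'rV[R]_m) :
    'M[R]_(m, tau) :=
  \matrix_(l < m, j < tau) a 0 l.

Record growth_conditions (R : realType) (m tau : nat)
    (P : 'I_m -> 'M[R]_(m, tau) -> R) (M E : 'rV[R]_m) : Prop :=
  GrowthConditions {
    growth_bounded : forall (i : 'I_m) (h : 'M[R]_(m, tau)),
      in_box 0 M h -> 0 <= P i h <= M 0 i;
    growth_lipschitz : exists2 L : R, 0 < L &
      forall (i : 'I_m) (h f : 'M[R]_(m, tau)), in_box 0 M h -> in_box 0 M f ->
        `|P i h - P i f| <= L * \sum_(l < m) \sum_(j < tau) `|h l j - f l j|;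
    growth_zero : forall i : 'I_m, P i 0 = 0;
    growth_fixpoint : forall i : 'I_m, P i (const_history tau E) = E 0 i;
    growth_order : forall i : 'I_m, 0 < E 0 i <= M 0 i
  }.

(* Lebesgue measurability and integration refer to the completed Lebesgue
   measure; [lebesgue_measure] only measures Borel sets. *)
Notation Leb R := (@completed_lebesgue_measure R).

Record kernel_conditions (R : realType) (k : R -> R) : Prop :=
  KernelConditions {
    kernel_ge0 : forall x : R, 0 <= k x;
    kernel_integrable : (Leb R).-integrable setT (fun y => (k y)%:E);
    kernel_even : forall x : R, k x = k (- x);
    kernel_mass : (\int[Leb R]_y (k y)%:E = 1)%E;
    kernel_exp_moment : forall lambda : R, 0 <= lambda ->
      (\int[Leb R]_y (k y * expR (lambda * y))%:E < +oo)%E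
  }.

(* Column j : 'I_tau carries the paper's index j + 1. *)
Definition history (R : realType) (m tau : nat) (c : R) (Phi : R -> 'rV[R]_m)
    (s : R) : 'M[R]_(m, tau) :=
  \matrix_(l < m, j < tau) Phi (s - (tau - j.+1)%:R * c) 0 l.

Definition reaction (R : realType) (m tau : nat)
    (P : 'I_m -> 'M[R]_(m, tau) -> R) (c : R) (Phi : R -> 'rV[R]_m)
    (i : 'I_m) (s : R) : R :=
  P i (history tau c Phi s).

(* The first two clauses say that the right-hand side makes sense as the
   convolution of a bounded function with an integrable kernel.  Nothing is
   assumed about P outside the box [0, M], so boundedness of the reaction term
   is not a consequence of boundedness of Phi; it is automatic if Phi takes its
   values in [0, M], or if P is continuous on the whole space. *)
Record wave_solution (R : realType) (m tau : nat)
    (P : 'I_m -> 'M[R]_(m, tau) -> R) (k : 'I_m -> R -> R) (c : R)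
    (Phi : R -> 'rV[R]_m) : Prop :=
  WaveSolution {
    wave_bounded : forall i : 'I_m, bounded_fun (reaction P c Phi i);
    wave_integrable : forall (i : 'I_m) (xi : R), (Leb R).-integrable setT
      (fun s => (reaction P c Phi i s * k i (xi - s - c))%:E);
    wave_eq : forall (i : 'I_m) (xi : R),
      ((Phi xi 0 i)%:E =
       \int[Leb R]_s (reaction P c Phi i s * k i (xi - s - c))%:E)%E
  }.

Record contracting_rectangle (R : realType) (m tau : nat)
    (P : 'I_m -> 'M[R]_(m, tau) -> R) (M E : 'rV[R]_m)
    (r t : R -> 'rV[R]_m) : Prop :=
  ContractingRectangle {
    rect_continuous : forall i : 'I_m,
      {within `[0, 1], continuous (fun s => r s 0 i)} /\
      {within `[0, 1], continuous (fun s => t s 0 i)};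
    rect_monotone : forall i : 'I_m,
      {in `[0, 1] &, {homo (fun s => r s 0 i) : x y / x < y}} /\
      {in `[0, 1] &, {homo (fun s => t s 0 i) : x y /~ x < y}};
    rect_lower : forall i : 'I_m, 0 <= r 0 0 i < r 1 0 i;
    rect_apex : r 1 = E /\ t 1 = E;
    rect_upper : forall i : 'I_m, t 1 0 i < t 0 0 i <= M 0 i;
    rect_contracting : forall (s : R) (i : 'I_m) (u : 'M[R]_(m, tau)),
      0 < s < 1 -> in_box (r s) (t s) u -> r s 0 i < P i u < t s 0 i
  }.

(* Main.v *)
Require Import Defs.
From mathcomp Require Import all_boot all_order all_algebra.
From mathcomp Require Import all_classical all_reals all_analysis.
From mathcomp Require Import measurable_realfun lra ring.

(** Let Q s say that every component of Phi has its liminf and limsup at +oo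
    between r_i(s) and t_i(s).  The hypothesis is Q s1, and Q 1 is the claim,
    since r 1 = E = t 1.  By continuity of r and t, Q holds at the supremum s of
    the parameters in [s1, 1] at which it holds ([interval_propagation]).

    Suppose that s < 1.  On the compact box [r s, t s] every P_i takes values
    strictly between r_i(s) and t_i(s), hence, by the extreme value theorem and
    the Lipschitz condition, stays there with a uniform margin on a slightly
    larger box ([box_margin]).  By Q s the histories of Phi eventually lie in
    that larger box, so the reaction term is eventually between r_i(s) and
    t_i(s) with a margin.  As Phi_i is the convolution of the reaction term with
    a probability kernel, it inherits these bounds up to an arbitrarily small
    loss ([convolution_eventually_ge]).  Thus Phi is eventually strictly inside
    the box ([contraction_step]), and by continuity Q holds slightly beyond s,
    against the choice of s.

    For the convolution bound, the kernel k(xi - s - c) must have mass one in s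
    and almost all of it far to the right as xi grows.  Since k is even, this
    follows from the translation invariance of the completed Lebesgue measure
    ([Leb_shift], [ge0_integral_shift]), which comes from the invariance of the
    lengths of the intervals that define the outer measure. *)

Set Implicit Arguments.
Unset Strict Implicit.
Unset Printing Implicit Defensive.

Import Order.TTheory GRing.Theory Num.Theory.
Import numFieldNormedType.Exports.

Local Open Scope classical_set_scope.
Local Open Scope ring_scope.

(** * Translation invariance of the completed Lebesgue measure *)

(** The real line with the Caratheodory sigma-algebra, on which [Leb R]
    lives; naming it makes measurability refer to Lebesgue measurable sets
    instead of Borel sets. *)
Definition Lline (R : realType) : measurableType _ :=
  caratheodory_type (wlength (@idfun R))^*%mu.

Lemma image_shift_itvoc (R : realType) (a x y : R) :
  (fun z => z + a) @` `]x, y] = `]x + a, y + a]%classic.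
Proof.
apply/seteqP; split=> [_ [z + <-]|z] /=.
  by rewrite !in_itv /= ltrD2r lerD2r.
rewrite in_itv /= => h; exists (z - a); last by rewrite subrK.
by rewrite /= in_itv /= ltrBrDr lerBlDr.
Qed.

(** Translating every half-open interval of a cover of X gives a cover of the
    translate of X with the same lengths.  As [Leb R] is the outer measure on
    all sets, X may be arbitrary. *)
Lemma Leb_shift_le (R : realType) (a : R) (X : set R) :
  (Leb R ((fun z => z + a)%R @` X) <= Leb R X)%E.
Proof.
apply: le_ereal_inf_tmp => _ [F [mF XF] <-].
apply: ereal_inf_lbound; exists (fun n => (fun z => z + a) @` F n).
  split.
    move=> n; have [[x y] _ <-] := mF n.
    by rewrite image_shift_itvoc; exact: is_ocitv.
  by move=> _ [z /XF[n _ Fnz] <-]; exists n => //; exists z.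
apply: eq_eseriesr => n _; have [[x y] _ <-] := mF n.
rewrite image_shift_itvoc /= !wlength_itv /= !lte_fin ltrD2r.
by case: ifP => // _; rewrite -!EFinB opprD addrACA subrr addr0.
Qed.

Lemma Leb_shift (R : realType) (a : R) (X : set R) :
  Leb R ((fun z => z + a) @^-1` X) = Leb R X.
Proof.
apply/eqP; rewrite eq_le; apply/andP; split.
  rewrite (_ : _ @^-1` X = (fun z => z + - a) @` X); first exact: Leb_shift_le.
  apply/seteqP; split=> [z Xz|_ [z Xz <-]] /=; last by rewrite subrK.
  by exists (z + a); rewrite ?addrK.
rewrite -[X in (Leb R X <= _)%E](_ :
    (fun z => z + a)%R @` ((fun z => z + a)%R @^-1` X) = X).
  exact: Leb_shift_le.
apply/seteqP; split=> [_ [z Xz <-]|z Xz] //=.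
by exists (z - a); rewrite /= subrK.
Qed.

(** Caratheodory's criterion only speaks of the outer measure, so it inherits
    the translation invariance of that outer measure. *)
Lemma measurable_shift (R : realType) (a : R) (X : set (Lline R)) :
  measurable X -> measurable ((fun z : R => z + a) @^-1` X : set (Lline R)).
Proof.
move=> mX.
suff: caratheodory_measurable (Leb R) ((fun z : R => z + a) @^-1` X) by [].
move=> Y; pose Y' := (fun z => z - a) @^-1` Y.
have YE : Y = (fun z => z + a) @^-1` Y'.
  by apply/seteqP; split=> z; rewrite /Y' /= addrK.
rewrite YE preimage_setC -!preimage_setI !(Leb_shift a).
exact: mX.
Qed.

Lemma measurable_fun_shift (R : realType) (a : R) :
  measurable_fun setT ((fun s : R => s + a) : Lline R -> Lline R).
Proof. by move=> _ Y mY; rewrite setTI; exact: measurable_shift. Qed.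

Lemma ge0_integral_shift (R : realType) (a : R) (D : set (Lline R))
    (f : Lline R -> \bar R) :
  measurable D ->
  measurable_fun D f ->
  (forall y, 0 <= f y)%E ->
  (\int[Leb R]_(y in D) f y
   = \int[Leb R]_(s in (fun s => s + a)%R @^-1` D) f (s + a)%R)%E.
Proof.
move=> mD mf f0.
have mphi := @measurable_fun_shift R a.
rewrite -[RHS](ge0_integral_pushforward mphi (Leb R) mD mf)//.
by apply: eq_measure_integral => A mA _; exact: esym (Leb_shift a A).
Qed.

Lemma measurable_Leb_itv (R : realType) (i : interval R) :
  measurable ([set` i] : set (Lline R)).
Proof. by apply: sub_caratheodory; exact: measurable_itv. Qed.

(** * Asymptotic bounds for convolutions *)

Lemma kernel_upper_mass_cvg1 (R : realType) (k : R -> R) :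
  kernel_conditions k ->
  (\int[Leb R]_(y in `](- n%:R)%R, +oo[) (k y)%:E @[n --> \oo] --> 1)%E.
Proof.
move=> hk; rewrite -(kernel_mass hk).
have mk := measurable_int _ (kernel_integrable hk).
have -> : [set: R] = \bigcup_n (`]- (n%:R : R), +oo[%classic).
  apply/seteqP; split=> // y _; exists (Num.truncn `|y|).+1 => //=.
  rewrite in_itv /= andbT ltrNl (le_lt_trans (ler_norm _)) //.
  by rewrite normrN; exact: truncnS_gt.
apply: ge0_nondecreasing_set_cvg_integral => /=.
- move=> p q pq; apply/subsetPset => y /=; rewrite !in_itv /= !andbT.
  by apply: le_lt_trans; rewrite lerN2 ler_nat.
- by move=> n; exact: measurable_Leb_itv.
- by move=> n; apply: measurable_funS mk.
- by move=> n y _; rewrite lee_fin (kernel_ge0 hk).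
Qed.

Lemma kernel_shift_mass (R : realType) (k : R -> R) (a : R) :
  kernel_conditions k -> (\int[Leb R]_s (k (s + a)%R)%:E = 1)%E.
Proof.
move=> hk; have mk := measurable_int _ (kernel_integrable hk).
rewrite -[LHS](ge0_integral_shift a (D := setT) (f := fun y => (k y)%:E))//.
  exact: (kernel_mass hk).
by move=> y; rewrite lee_fin (kernel_ge0 hk).
Qed.

Lemma kernel_shift_integrable (R : realType) (k : R -> R) (a : R) :
  kernel_conditions k ->
  (Leb R).-integrable setT (fun s => (k (s + a))%:E).
Proof.
move=> hk; have mk := measurable_int _ (kernel_integrable hk).
apply/integrableP; split.
  exact: measurableT_comp mk (measurable_fun_shift a).
under eq_integral => s _ do rewrite gee0_abs ?lee_fin ?(kernel_ge0 hk)//.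
by rewrite kernel_shift_mass// ltry.
Qed.

(** Adding C makes the integrand nonnegative, so that the complement of D,
    where nothing but g >= - C is known, may be dropped; on D the sum g + C is
    at least a + C.  K is a probability density, so C adds C to the mean. *)
Lemma mean_lower_bound (R : realType) d (T : measurableType d)
    (mu : {measure set T -> \bar R}) (D : set T) (g K : T -> R) (a C : R) :
  measurable D ->
  mu.-integrable setT (fun s => (g s * K s)%:E) ->
  mu.-integrable setT (fun s => (K s)%:E) ->
  (\int[mu]_s (K s)%:E = 1)%E ->
  (forall s, 0 <= K s) -> (forall s, 0 <= g s + C) -> 0 <= a + C ->
  (forall s, D s -> a <= g s) ->
  ((a + C)%:E * \int[mu]_(s in D) (K s)%:E
    <= \int[mu]_s (g s * K s)%:E + C%:E)%E.
Proof.
move=> mD igK iK K1 K0 gC aC ga.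
have iCK : mu.-integrable setT (fun s => (C%:E * (K s)%:E)%E).
  exact: integrableZl.
have iS := integrableD measurableT igK iCK.
have -> : (\int[mu]_s (g s * K s)%:E + C%:E =
    \int[mu]_s ((g s * K s)%:E + C%:E * (K s)%:E))%E.
  by rewrite integralD// integralZl// K1 mule1.
rewrite -ge0_integralZl_EFin//; last 2 first.
- by move=> s _; rewrite lee_fin.
- exact: measurable_funS (measurable_int _ iK).
apply: (@le_trans _ _
    (\int[mu]_(s in D) ((g s * K s)%:E + C%:E * (K s)%:E))%E).
  apply: ge0_le_integral => //.
  - by move=> s _; rewrite -EFinM lee_fin mulr_ge0.
  - by apply/measurable_funeM; exact: measurable_funS (measurable_int _ iK).
  - exact: measurable_funS (measurable_int _ iS).
  - move=> s Ds; rewrite -!EFinM -EFinD lee_fin -mulrDl ler_wpM2r//.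
    by rewrite lerD2r ga.
apply: ge0_subset_integral => //; first exact: measurable_int iS.
by move=> s _; rewrite -EFinM -EFinD lee_fin -mulrDl mulr_ge0.
Qed.

(** An asymptotic lower bound for g passes to its convolution with a
    probability kernel: for large xi nearly all the mass of k (xi - s - c) sits
    at s > S, where g is at least a, and the remaining mass contributes little
    because g is bounded. *)
Lemma convolution_eventually_ge (R : realType) (k g w : R -> R)
    (a c S B e : R) :
  kernel_conditions k -> (forall s, `|g s| <= B) ->
  (forall s, S < s -> a <= g s) ->
  (forall xi, (Leb R).-integrable setT
     (fun s => (g s * k (xi - s - c))%:E)) ->
  (forall xi, ((w xi)%:E = \int[Leb R]_s (g s * k (xi - s - c))%:E)%E) ->
  0 < e -> \forall xi \near +oo, a - e <= w xi.
Proof.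
move=> hk gB ga ig wE e0.
(* C bounds g from below and, being at least |a|, makes a + C nonnegative. *)
pose C := Num.max B `|a|.
have gC s : 0 <= g s + C.
  rewrite -lerBlDr sub0r lerNl (le_trans (ler_norm _))// normrN.
  by rewrite (le_trans (gB s))// le_max lexx.
have aC : 0 <= a + C.
  have : `|a| <= C by rewrite le_max lexx orbT.
  have := ler_norm (- a); rewrite normrN; lra.
have mk := measurable_int _ (kernel_integrable hk).
have [n mn] : exists n : nat, ((1 - e / (a + C + 1))%:E <
    \int[Leb R]_(y in `](- n%:R)%R, +oo[) (k y)%:E)%E.
  have lt1 : ((1 - e / (a + C + 1))%:E < 1%:E :> \bar R)%E.
    by rewrite lte_fin ltrBlDr ltrDl divr_gt0//; lra.
  have [N _ HN] := kernel_upper_mass_cvg1 hk (open_ereal_gt' lt1).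
  by exists N; exact: (HN N (leqnn N)).
near=> xi.
have Sxi : S <= xi - c - n%:R.
  by rewrite !lerBrDr; near: xi; apply: nbhs_pinfty_ge; exact: num_real.
(* Evenness of k turns the reflected argument into a translated one. *)
have kE s : k (xi - s - c) = k (s + (c - xi)).
  by rewrite (kernel_even hk); congr k; ring.
pose K s := k (s + (c - xi)).
have iK : (Leb R).-integrable setT (fun s => (K s)%:E).
  exact: kernel_shift_integrable.
have K0 s : 0 <= K s by exact: (kernel_ge0 hk).
have igK : (Leb R).-integrable setT (fun s => (g s * K s)%:E).
  by have := ig xi; under eq_fun do rewrite kE.
(* D is where the translated argument exceeds - n, and there g is at least a. *)
pose D : set (Lline R) := (fun s => s + (c - xi))%R @^-1` `](- n%:R)%R, +oo[.
have mD : measurable D by apply: measurable_shift; exact: measurable_Leb_itv.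
have lb : ((a + C)%:E * \int[Leb R]_(s in D) (K s)%:E <= (w xi + C)%:E)%E.
  have -> : (w xi + C)%:E = (\int[Leb R]_s (g s * K s)%:E + C%:E)%E.
    by rewrite EFinD wE; congr (_ + _)%E; apply: eq_integral => s _; rewrite kE.
  apply: mean_lower_bound mD igK iK (kernel_shift_mass _ hk) K0 gC aC _ => s.
  rewrite /D /= in_itv /= andbT => Ds; apply: ga.
  by move: Ds Sxi; clear; lra.
rewrite -(ge0_integral_shift (c - xi) (f := fun y => (k y)%:E)) in lb;
  last 3 first.
- exact: measurable_Leb_itv.
- exact: measurable_funS mk.
- by move=> y; rewrite lee_fin (kernel_ge0 hk).
have : ((a + C)%:E * (1 - e / (a + C + 1))%:E <= (w xi + C)%:E)%E.
  by apply: le_trans lb; apply: lee_wpmul2l; rewrite ?lee_fin//; exact: ltW.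
rewrite -EFinM lee_fin => h.
have he : (a + C) * (e / (a + C + 1)) <= e.
  rewrite mulrCA ler_piMr ?(ltW e0)// ler_pdivrMr ?ltr_wpDl//.
  by rewrite mul1r lerDl.
by move: h he; clear; rewrite mulrBr mulr1; lra.
Unshelve. all: by end_near. Qed.

Lemma convolution_eventually_le (R : realType) (k g w : R -> R)
    (a c S B e : R) :
  kernel_conditions k -> (forall s, `|g s| <= B) ->
  (forall s, S < s -> g s <= a) ->
  (forall xi, (Leb R).-integrable setT
     (fun s => (g s * k (xi - s - c))%:E)) ->
  (forall xi, ((w xi)%:E = \int[Leb R]_s (g s * k (xi - s - c))%:E)%E) ->
  0 < e -> \forall xi \near +oo, w xi <= a + e.
Proof.
move=> hk gB ga ig wE e0.
have : \forall xi \near +oo, - a - e <= - w xi.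
  apply: (@convolution_eventually_ge _ k (fun s => - g s) (fun s => - w s)
    (- a) c S B) => //.
  - by move=> s; rewrite normrN.
  - by move=> s /ga; rewrite lerN2.
  - move=> xi; have := integrableN (ig xi).
    by apply: eq_integrable => // s _; rewrite mulNr.
  - move=> xi; rewrite EFinN wE -integralN/=; last exact: integrable_add_def.
    by apply: eq_integral => s _; rewrite mulNr.
by apply: filterS => xi; lra.
Qed.

(** * Uniform margins on compact boxes *)

(** Matrices are flattened to row vectors, for which products of compact
    sets are known to be compact. *)
Lemma box_compact (R : realType) (m tau : nat) (a b : 'rV[R]_m) :
  compact [set v : 'rV[R]_(m * tau) | in_box a b (vec_mx v : 'M[R]_(m, tau))].
Proof.
pose corner (x : 'rV[R]_m) := mxvec (const_history tau x).
rewrite (_ : mkset _ = [set v : 'rV[R]_(m * tau) |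
    forall k, `[corner a 0 k, corner b 0 k]%classic (v 0 k)]).
  apply: (@rV_compact _ _ (fun k => `[corner a 0 k, corner b 0 k]%classic)).
  by move=> k; exact: segment_compact.
apply/seteqP; split=> v vab.
  case/mxvec_indexP => l j; rewrite /= in_itv /= /corner !mxvecE !mxE.
  by have := vab l j; rewrite mxE.
move=> l j; have := vab (mxvec_index l j).
by rewrite /= in_itv /= /corner !mxvecE !mxE.
Qed.

Lemma sum_const_entries (R : realType) (m tau : nat) (d : R) :
  \sum_(l < m) \sum_(j < tau) d = d * (m * tau)%:R.
Proof. by rewrite !sumr_const !card_ord -mulrnA mulr_natr mulnC. Qed.

Lemma lipschitz_within_box (R : realType) (m tau : nat) (a b : 'rV[R]_m)
    (F : 'M[R]_(m, tau) -> R) (L : R) :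
  0 < L ->
  (forall h f, in_box a b h -> in_box a b f ->
    `|F h - F f| <= L * \sum_(l < m) \sum_(j < tau) `|h l j - f l j|) ->
  {within [set v : 'rV[R]_(m * tau) | in_box a b (vec_mx v : 'M[R]_(m, tau))],
    continuous (F \o vec_mx)}.
Proof.
move=> L0 lipF; apply/subspace_continuousP => v vab.
apply/cvgrPdist_le => e e0.
pose d := e / (L * (m * tau)%:R + 1).
have den0 : 0 < L * (m * tau)%:R + 1 by rewrite ltr_wpDl// mulr_ge0// ltW.
have d0 : 0 < d by rewrite divr_gt0.
rewrite near_withinE; apply/nbhs_ballP; exists d => //= w [_ vw] wab.
apply: le_trans (lipF _ _ vab wab) _.
apply: (@le_trans _ _ (L * (\sum_(l < m) \sum_(j < tau) d))).
  rewrite ler_pM2l//; apply: ler_sum => l _; apply: ler_sum => j _.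
  by rewrite !mxE ltW//; exact: vw.
rewrite sum_const_entries mulrCA /d mulrAC ler_pdivrMr// ler_pM2l//.
by rewrite lerDl.
Qed.

(** A strict lower bound on a compact box is a uniform one, because F attains
    its minimum there; Lipschitz continuity keeps it, with a smaller margin, on
    a slightly larger box.  The same e serves as margin and as enlargement, and
    the points of the larger box are restricted to [0, M], where alone F is
    known to be Lipschitz. *)
Lemma box_margin (R : realType) (m tau : nat) (M a b : 'rV[R]_m)
    (F : 'M[R]_(m, tau) -> R) (p : R) :
  (exists2 L : R, 0 < L &
    forall h f, in_box 0 M h -> in_box 0 M f ->
    `|F h - F f| <= L * \sum_(l < m) \sum_(j < tau) `|h l j - f l j|) ->
  (forall l, 0 <= a 0 l) -> (forall l, a 0 l <= b 0 l) ->
  (forall l, b 0 l <= M 0 l) ->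
  (forall u, in_box a b u -> p < F u) ->
  exists2 e, 0 < e & forall h, in_box 0 M h ->
    in_box (a - const_mx e) (b + const_mx e) h -> p + e <= F h.
Proof.
move=> [L L0 lipF] a0 ab bM Fp.
have abM (u : 'M[R]_(m, tau)) : in_box a b u -> in_box 0 M u.
  move=> uab l j; have /andP[h1 h2] := uab l j; rewrite mxE.
  by rewrite (le_trans (a0 l) h1) (le_trans h2).
pose A := [set v : 'rV[R]_(m * tau) | in_box a b (vec_mx v : 'M[R]_(m, tau))].
have [v vA vmin] : exists2 v, v \in A & forall w, w \in A ->
    (F \o vec_mx) v <= (F \o vec_mx) w.
  apply: EVT_min_rV; last 2 first.
  - exact: box_compact.
  - by apply: (lipschitz_within_box L0) => h f /abM ? /abM; exact: lipF.
  exists (mxvec (const_history tau a)); rewrite /A /= mxvecK => l j.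
  by rewrite mxE lexx ab.
have pv : p < F (vec_mx v) by apply: Fp; move: vA; rewrite inE.
have cn0 : 0 <= L * (m * tau)%:R by rewrite mulr_ge0// ltW.
(* The gap F v - p is split as e + e * L * (m * tau): one share remains as the
   margin, the other pays for moving h back into the box. *)
exists ((F (vec_mx v) - p) / (L * (m * tau)%:R + 1)).
  by rewrite divr_gt0// ?subr_gt0// ltr_wpDl.
set e := _ / _ => h hM hab.
have eE : e * (L * (m * tau)%:R) + e = F (vec_mx v) - p.
  by rewrite -[X in _ + X]mulr1 -mulrDr /e divfK// gt_eqF// ltr_wpDl.
have e0 : 0 < e by rewrite divr_gt0// ?subr_gt0// ltr_wpDl.
(* The nearest point of the box, to which h is compared. *)
pose u : 'M[R]_(m, tau) :=
  \matrix_(l, j) Num.max (a 0 l) (Num.min (b 0 l) (h l j)).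
have uab : in_box a b u.
  by move=> l j; rewrite mxE le_max lexx /= ge_max ab ge_min lexx.
have uh l j : `|h l j - u l j| <= e.
  have /andP[] := hab l j; rewrite !mxE => h1 h2.
  rewrite ler_norml; have := ab l.
  by rewrite /Num.max /Num.min; do 2 case: ifPn; rewrite -?leNgt; lra.
have Fu : F (vec_mx v) <= F u.
  by have := vmin (mxvec u); rewrite /A inE /= mxvecK; exact.
have : `|F h - F u| <= e * (L * (m * tau)%:R).
  apply: le_trans (lipF _ _ hM (abM _ uab)) _.
  rewrite mulrCA ler_pM2l//.
  apply: (@le_trans _ _ (\sum_(l < m) \sum_(j < tau) e)).
    by apply: ler_sum => l _; apply: ler_sum => j _.
  by rewrite sum_const_entries.
rewrite ler_norml => /andP[] *; lra.
Qed.

(** * Propagation along a real parameter *)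

(** The supremum of the parameters at which Q holds satisfies Q by the limit
    hypothesis; it cannot be smaller than 1, since the step hypothesis would
    move it up. *)
Lemma interval_propagation (R : realType) (Q : R -> Prop) (s1 : R) :
  s1 <= 1 -> Q s1 ->
  (forall s, s1 <= s <= 1 ->
     (forall d, 0 < d -> exists2 u, s1 <= u <= 1 & `|s - u| < d /\ Q u) ->
     Q s) ->
  (forall s, s1 <= s < 1 -> Q s -> exists2 u, s < u <= 1 & Q u) ->
  Q 1.
Proof.
move=> s11 Qs1 Qlim Qstep.
pose A := [set u | s1 <= u <= 1 /\ Q u].
have As1 : A s1 by split; rewrite ?lexx.
have supA : has_sup A by split; [exists s1|exists 1 => u [/andP[]]].
have s1A : s1 <= sup A by exact: (ub_le_sup supA.2).
have A1 : sup A <= 1 by apply: ge_sup; [exists s1|move=> u [/andP[]]].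
have QA : Q (sup A).
  apply: Qlim => [|d d0]; first by rewrite s1A A1.
  have [u [u1 Qu] ud] := sup_adherent d0 supA.
  exists u => //; split => //.
  rewrite ger0_norm ?subr_ge0 ?ltrBlDr -?ltrBlDl//.
  exact: (ub_le_sup supA.2).
move: A1; rewrite le_eqVlt => /predU1P[<-//|A1].
have [|u /andP[Au u1] Qu] := Qstep (sup A) _ QA; first by rewrite s1A A1.
have : u <= sup A.
  by apply: (ub_le_sup supA.2); split=> //; rewrite u1 (le_trans s1A)// ltW.
by rewrite leNgt Au.
Qed.

Lemma itv_continuous_dist (R : realType) (f : R -> R) (s e : R) :
  {within `[0, 1], continuous f} -> 0 <= s <= 1 -> 0 < e ->
  exists2 d, 0 < d & forall u, 0 <= u <= 1 -> `|s - u| < d -> `|f s - f u| < e.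
Proof.
move=> /subspace_continuousP fc s01 e0.
have := fc s; rewrite /= in_itv /= => /(_ s01) /cvgrPdist_lt /(_ e e0).
rewrite near_withinE => /nbhs_ballP[d /= d0 sd].
by exists d => // u u01 su; apply: sd.
Qed.

(** * Asymptotic bounds of vector-valued functions *)

(** Encodes the bounds a on the liminf and b on the limsup without extended
    reals: the slack e makes the non-strict bounds hold eventually, which is
    the form that estimates use. *)
Definition eventually_between (R : realType) (m : nat) (Phi : R -> 'rV[R]_m)
    (a b : 'rV[R]_m) : Prop :=
  forall (i : 'I_m) (e : R), 0 < e ->
    \forall xi \near +oo, a 0 i - e <= Phi xi 0 i <= b 0 i + e.

Lemma limf_einf_ge_near (R : realType) (f : R -> R) (a e : R) :
  (a%:E <= limf_einf (fun x => (f x)%:E) (pinfty_nbhs R))%E -> 0 < e ->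
  \forall x \near +oo, a - e <= f x.
Proof.
rewrite limf_einfE => h e0.
have /ereal_sup_gt[_ [V FV <-] lt] : ((a - e)%:E < ereal_sup
    [set ereal_inf ((fun x => (f x)%:E) @` V) | V in pinfty_nbhs R])%E.
  by apply: lt_le_trans h; rewrite lte_fin gtrBl.
apply: filterS FV => x Vx; rewrite -lee_fin (le_trans (ltW lt))//.
by apply: ereal_inf_lbound; exists x.
Qed.

Lemma limf_esup_le_near (R : realType) (f : R -> R) (a e : R) :
  (limf_esup (fun x => (f x)%:E) (pinfty_nbhs R) <= a%:E)%E -> 0 < e ->
  \forall x \near +oo, f x <= a + e.
Proof.
rewrite limf_esupE => h e0.
have /ereal_inf_lt[_ [V FV <-] lt] : (ereal_inf
    [set ereal_sup ((fun x => (f x)%:E) @` V) | V in pinfty_nbhs R]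
    < (a + e)%:E)%E.
  by apply: le_lt_trans h _; rewrite lte_fin ltrDl.
apply: filterS FV => x Vx; rewrite -lee_fin (le_trans _ (ltW lt))//.
by apply: ereal_sup_ubound; exists x.
Qed.

Lemma eventually_between_cvg (R : realType) (m : nat) (Phi : R -> 'rV[R]_m)
    (E : 'rV[R]_m) :
  eventually_between Phi E E -> Phi xi @[xi --> +oo] --> E.
Proof.
move=> h; apply/cvg_ballP => e e0; near=> xi.
split=> // l i; rewrite (ord1 l); suff: `|E 0 i - Phi xi 0 i| <= e / 2.
  by move/le_lt_trans; apply; lra.
have : E 0 i - e / 2 <= Phi xi 0 i <= E 0 i + e / 2.
  by move: i; near: xi; apply: filter_forall => i; apply: h; rewrite divr_gt0.
by move=> /andP[? ?]; rewrite ler_norml; lra.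
Unshelve. all: by end_near. Qed.

(** All delays are nonnegative and at most [tau * c]. *)
Lemma history_eventually_in_box (R : realType) (m tau : nat) (c : R)
    (Phi : R -> 'rV[R]_m) (a b : 'rV[R]_m) :
  0 < c -> (\forall xi \near +oo, forall l, a 0 l <= Phi xi 0 l <= b 0 l) ->
  \forall s \near +oo, in_box a b (history tau c Phi s).
Proof.
move=> c0 [X [_ HX]]; near=> s => l j; rewrite mxE; apply: HX.
have : (tau - j.+1)%:R * c <= tau%:R * c.
  by rewrite ler_pM2r// ler_nat leq_subr.
have : X + tau%:R * c < s.
  by near: s; apply: nbhs_pinfty_gt; exact: num_real.
lra.
Unshelve. all: by end_near. Qed.

(** * Convergence of the wave *)

(** The heart of the argument: asymptotic bounds [a, b] that P maps strictly
    inside themselves improve by a positive margin.  Histories of Phi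
    eventually lie in a slight enlargement of the box, hence the reaction term
    is eventually inside [a, b] with a margin, and the convolution with k keeps
    half of it. *)
Lemma contraction_step (R : realType) (m tau : nat)
    (P : 'I_m -> 'M[R]_(m, tau) -> R) (M E : 'rV[R]_m) (k : 'I_m -> R -> R)
    (c : R) (Phi : R -> 'rV[R]_m) (a b : 'rV[R]_m) :
  growth_conditions P M E -> (forall i, kernel_conditions (k i)) -> 0 < c ->
  (forall i xi, 0 < Phi xi 0 i) -> wave_solution P k c Phi ->
  (forall l, 0 <= a 0 l) -> (forall l, a 0 l <= b 0 l) ->
  (forall l, b 0 l < M 0 l) ->
  (forall i u, in_box a b u -> a 0 i < P i u < b 0 i) ->
  eventually_between Phi a b ->
  forall i, exists2 e, 0 < e &
    \forall xi \near +oo, a 0 i + e <= Phi xi 0 i <= b 0 i - e.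
Proof.
move=> hP hk c0 Phi0 hPhi a0 ab bM Pab Phiab i.
have [L L0 lipP] := growth_lipschitz hP.
have bM' l : b 0 l <= M 0 l by exact: ltW.
have [e1 e10 lo] : exists2 e, 0 < e & forall h, in_box 0 M h ->
    in_box (a - const_mx e) (b + const_mx e) h -> a 0 i + e <= P i h.
  apply: box_margin => //; first by exists L => //; exact: lipP.
  by move=> u /(Pab i) /andP[].
have [e2 e20 up] : exists2 e, 0 < e & forall h, in_box 0 M h ->
    in_box (a - const_mx e) (b + const_mx e) h -> - b 0 i + e <= - P i h.
  apply: (box_margin (F := fun h => - P i h)) => //.
    exists L => // h f hM fM; rewrite -opprD normrN; exact: lipP.
  by move=> u /(Pab i) /andP[]; rewrite ltrN2.
have near_box e : 0 < e ->
    \forall s \near +oo, in_box (a - const_mx e) (b + const_mx e)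
      (history tau c Phi s).
  move=> e0; apply: history_eventually_in_box => //.
  apply: filter_forall => l; rewrite !mxE; exact: Phiab.
(* Phi has positive values and b < M, so Phi eventually stays in [0, M], where
   the Lipschitz bound holds. *)
have near_M : \forall s \near +oo, in_box 0 M (history tau c Phi s).
  apply: history_eventually_in_box => //; apply: filter_forall => l.
  have : 0 < M 0 l - b 0 l by rewrite subr_gt0.
  move=> /(Phiab l); apply: filterS => xi /andP[_ le].
  by rewrite mxE (ltW (Phi0 _ _)) (le_trans le)// addrC subrK.
have [B PB] : exists B, forall s, `|reaction P c Phi i s| <= B.
  have [B [_ hB]] := wave_bounded hPhi i.
  by exists (B + 1) => s; apply: hB => //; rewrite ltrDl.
have [S [_ HS]] : \forall s \near +oo,
    a 0 i + e1 <= reaction P c Phi i s <= b 0 i - e2.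
  near=> s; have sM : in_box 0 M (history tau c Phi s) by near: s.
  apply/andP; split; first by apply: lo => //; near: s; exact: near_box.
  suff : - b 0 i + e2 <= - P i (history tau c Phi s) by rewrite /reaction; lra.
  by apply: up => //; near: s; exact: near_box.
have e1h : 0 < e1 / 2 by rewrite divr_gt0.
have e2h : 0 < e2 / 2 by rewrite divr_gt0.
have loPhi := convolution_eventually_ge (hk i) PB
  (fun s Ss => proj1 (andP (HS s Ss)))
  (wave_integrable hPhi i) (wave_eq hPhi i) e1h.
have upPhi := convolution_eventually_le (hk i) PB
  (fun s Ss => proj2 (andP (HS s Ss)))
  (wave_integrable hPhi i) (wave_eq hPhi i) e2h.
exists (Num.min (e1 / 2) (e2 / 2)); first by rewrite lt_min e1h.
have m1 : Num.min (e1 / 2) (e2 / 2) <= e1 / 2 by rewrite ge_min lexx.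
have m2 : Num.min (e1 / 2) (e2 / 2) <= e2 / 2 by rewrite ge_min lexx orbT.
near=> xi; apply/andP; split.
  have : a 0 i + e1 - e1 / 2 <= Phi xi 0 i by near: xi.
  lra.
have : Phi xi 0 i <= b 0 i - e2 + e2 / 2 by near: xi.
lra.
Unshelve. all: by end_near. Qed.

Theorem theorem4p3 (R : realType) (m tau : nat) (hm : (0 < m)%N)
  (htau : (0 < tau)%N)
  (P : 'I_m -> 'M[R]_(m, tau) -> R) (M E : 'rV[R]_m) (k : 'I_m -> R -> R)
  (hP : growth_conditions P M E) (hk : forall i : 'I_m, kernel_conditions (k i))
  (c : R) (hc : 0 < c)
  (Phi : R -> 'rV[R]_m)
  (Phi_uc : unif_continuous Phi) (Phi_bounded : bounded_fun Phi)
  (Phi_pos : forall (i : 'I_m) (xi : R), 0 < Phi xi 0 i)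
  (Phi_sol : wave_solution P k c Phi)
  (r t : R -> 'rV[R]_m) (hrt : contracting_rectangle P M E r t)
  (s1 : R) (hs1 : 0 < s1 < 1)
  (hlim : forall i : 'I_m,
    ((r s1 0 i)%:E <= limf_einf (fun xi => (Phi xi 0 i)%:E) (pinfty_nbhs R)
       <= limf_esup (fun xi => (Phi xi 0 i)%:E) (pinfty_nbhs R))%E /\
    (limf_esup (fun xi => (Phi xi 0 i)%:E) (pinfty_nbhs R)
       <= (t s1 0 i)%:E)%E) :
  Phi xi @[xi --> +oo] --> E.
Proof.
have [rE tE] := rect_apex hrt.
have /andP[s10 s11] := hs1.
have rdist i s e :=
  @itv_continuous_dist _ _ s e (proj1 (rect_continuous hrt i)).
have tdist i s e :=
  @itv_continuous_dist _ _ s e (proj2 (rect_continuous hrt i)).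
suff : eventually_between Phi (r 1) (t 1).
  by rewrite rE tE; exact: eventually_between_cvg.
apply: (@interval_propagation _ (fun s => eventually_between Phi (r s) (t s))
  s1 (ltW s11)).
- move=> i e e0; have [/andP[lo _] up] := hlim i.
  have := limf_einf_ge_near lo e0; have := limf_esup_le_near up e0.
  by apply: filterS2 => xi ? ?; apply/andP.
- move=> s /andP[s1s s_1] near_s i e e0.
  have s01 : 0 <= s <= 1 by apply/andP; split; lra.
  have e20 : 0 < e / 2 by rewrite divr_gt0.
  have [d1 d10 hd1] := rdist i s _ s01 e20.
  have [d2 d20 hd2] := tdist i s _ s01 e20.
  have [|u /andP[u0 u1] [su Qu]] := near_s (Num.min d1 d2).
    by rewrite lt_min d10.
  move: su; rewrite lt_min => /andP[su1 su2].
  have u01 : 0 <= u <= 1 by apply/andP; split; lra.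
  have := hd1 u u01 su1; have := hd2 u u01 su2.
  rewrite !ltr_norml => /andP[? ?] /andP[? ?].
  have := Qu i _ e20; apply: filterS => xi /andP[? ?]; apply/andP; split; lra.
move=> s /andP[s1s s_1] Qs.
have s01 : 0 < s < 1 by apply/andP; split; lra.
have s01w : 0 <= s <= 1 by apply/andP; split; lra.
have rmono i (x y : R) : 0 <= x <= 1 -> 0 <= y <= 1 -> x < y ->
    r x 0 i < r y 0 i.
  move=> x01 y01 xy; apply: (proj1 (rect_monotone hrt i)) => //;
    by rewrite in_itv.
have tmono i (x y : R) : 0 <= x <= 1 -> 0 <= y <= 1 -> x < y ->
    t y 0 i < t x 0 i.
  move=> x01 y01 xy; apply: (proj2 (rect_monotone hrt i)) => //;
    by rewrite in_itv.
have zero01 : 0 <= (0 : R) <= 1 by apply/andP; split; lra.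
have one01 : 0 <= (1 : R) <= 1 by apply/andP; split; lra.
(* Strict monotonicity and 0 < s keep the box of s away from the faces of
   [0, M], and the contraction property then leaves room to move s up. *)
have improve := contraction_step hP hk hc Phi_pos Phi_sol (a := r s) (b := t s).
have {}improve i : exists2 e, 0 < e &
    \forall xi \near +oo, r s 0 i + e <= Phi xi 0 i <= t s 0 i - e.
  apply: improve => //.
  - move=> l; have /andP[r0 _] := rect_lower hrt l.
    by rewrite (le_trans r0)// ltW// rmono//; lra.
  - move=> l; have := rmono l s 1 s01w one01 s_1.
    have := tmono l s 1 s01w one01 s_1; rewrite rE tE; lra.
  - move=> l; have /andP[_ t0] := rect_upper hrt l.
    by rewrite (lt_le_trans _ t0)// tmono//; lra.
  - by move=> l u; exact: (rect_contracting hrt).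
have : \forall u \near s^'+, forall i,
    \forall xi \near +oo, r u 0 i <= Phi xi 0 i <= t u 0 i.
  apply: filter_forall => i; have [e e0 he] := improve i.
  have [d1 d10 hd1] := rdist i s _ s01w e0.
  have [d2 d20 hd2] := tdist i s _ s01w e0.
  near=> u.
  have su : s < u by near: u; exact: nbhs_right_gt.
  have u1 : u < 1 by near: u; exact: nbhs_right_lt.
  have ud1 : u < s + d1 by near: u; apply: nbhs_right_lt; lra.
  have ud2 : u < s + d2 by near: u; apply: nbhs_right_lt; lra.
  have u01 : 0 <= u <= 1 by apply/andP; split; lra.
  have su1 : `|s - u| < d1 by rewrite ltr_norml; apply/andP; split; lra.
  have su2 : `|s - u| < d2 by rewrite ltr_norml; apply/andP; split; lra.
  have := hd1 u u01 su1; have := hd2 u u01 su2.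
  rewrite !ltr_norml => /andP[? ?] /andP[? ?].
  by apply: filterS he => xi /andP[? ?]; apply/andP; split; lra.
move=> near_u.
have [u [[su u1] Qu]] := filter_ex
  (filterI (filterI (nbhs_right_gt s) (nbhs_right_lt s_1)) near_u).
exists u; first by rewrite su ltW.
move=> i e e0; apply: filterS (Qu i) => xi /andP[? ?].
by apply/andP; split; lra.
Unshelve. all: by end_near. Qed.
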